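(* Let $i\ge 0$, let $K$ be an orientable, $(i+1)$-path connected, $(i+1)$-dimensional finite abstract simplicial complex, and let $\lambda$ be an eigenvalue of the normalized $i$-up Laplacian $\Delta_i^{\mathrm{up}}$ with $\lambda\neq i+2$. Let $k\in\mathbb{R}$ and assume that $\kappa(F,F')\ge k$ for all $i$-faces $F,F'$ of $K$ with $F\sim F'$. Then $$(i+1)k-i\ \le\ \lambda\ \le\ (i+2)-(i+1)k.$$
   Context: An abstract simplicial complex $K$ is a collection of subsets of a finite set that is closed under inclusion. An $i$-face is an element of $K$ of cardinality $i+1$; $S_i(K)$ is the set of $i$-faces. The dimension of $K$ is the maximum dimension of its faces. Facets are the faces that are maximal under inclusion. For an $(i+1)$-face $\bar F$, $F\in\partial\bar F$ means that $F$ is an $i$-face contained in $\bar F$. Weights and degree: a weight function $w$ assigns a positive real number to each nonempty face, and $\deg F=\sum_{\bar F\in S_{i+1}(K):\,F\in\partial\bar F}w(\bar F)$ for an $i$-face $F$. Here the normalized weights are used: $w(F)=1$ if $F$ is a facet and $w(F)=\deg F$ if $F$ is not a facet. Orientation and Laplacian: an oriented face $[F]$ is a face with a chosen ordering of its vertices (up to even permutation). $C^i(K,\mathbb{R})$ is the dual of the real vector space $C_i(K,\mathbb{R})$ with basis $\{[F]:F\in S_i(K)\}$ (odd permutations of vertices change the sign). The coboundary $\delta_i:C^i(K,\mathbb{R})\to C^{i+1}(K,\mathbb{R})$ is $(\delta_if)([v_0,\dots,v_{i+1}])=\sum_{j=0}^{i+1}(-1)^jf([v_0,\dots,\hat v_j,\dots,v_{i+1}])$.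 The inner product on $C^i(K,\mathbb{R})$ is $(f,g)=\sum_{F\in S_i(K)}w(F)f([F])g([F])$, and $\delta_i^*$ is the adjoint of $\delta_i$. With the normalized weights, $\Delta_i^{\mathrm{up}}=\delta_i^*\delta_i$ on $C^i(K,\mathbb{R})$. The boundary of $[F]=[v_0,\dots,v_{i+1}]$ is $\partial[F]=\sum_j(-1)^j[v_0,\dots,\hat v_j,\dots,v_{i+1}]$, and $\mathrm{sgn}([E],\partial[F])\in\{\pm1\}$ is the coefficient of $[E]$ in $\partial[F]$. Neighbours and distance: two distinct $i$-faces $F,F'$ are connected, written $F\sim F'$, if there is an $(i+1)$-face $\bar F$ with $F,F'\in\partial\bar F$. A path of length $n$ from $F$ to $F'$ is a sequence of $i$-faces $F=F_0\sim F_1\sim\dots\sim F_n=F'$; $d(F,F')$ is the length of a shortest path. $K$ is $(i+1)$-path connected if any two $i$-faces can be connected by a path. Orientable: an $(i+1)$-path connected $K$ is orientable if orientations of its $(i+1)$-faces and $i$-faces can be chosen such that $\mathrm{sgn}([E],\partial[F])\,\mathrm{sgn}([E'],\partial[F])=1$ for every $(i+1)$-face $F$ and all $i$-faces $E,E'\in\partial F$. Ricci curvature: for $F\in S_i(K)$ with $\deg F>0$, $m_F$ is the probability measure on $S_i(K)$ given by $m_F(F')=\frac{w(\bar F)}{(i+1)\deg F}$ if $F'\neq F$ and there is $\bar F\in S_{i+1}(K)$ with $F,F'\in\partial\bar F$ (such $\bar F$ is then unique), and $m_F(F')=0$ otherwise. For probability measures $\mu,\nu$ on $S_i(K)$, $W(\mu,\nu)=\inf_A\sum_{u,v}A(u,v)d(u,v)$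 over maps $A:S_i(K)\times S_i(K)\to[0,1]$ with $\sum_vA(u,v)=\mu(u)$ and $\sum_uA(u,v)=\nu(v)$. For distinct $i$-faces, $\kappa(F,F')=1-\frac{W(m_F,m_{F'})}{d(F,F')}$. *)

(* Defs.v *)
From HB Require Import structures.
From mathcomp Require Import boolp classical_sets reals.
From mathcomp Require Import all_boot all_order all_algebra all_fingroup.

Set Implicit Arguments.
Unset Strict Implicit.
Unset Printing Implicit Defensive.

Import Order.TTheory GRing.Theory Num.Theory.
Local Open Scope ring_scope.

Section Faces.
Variable V : finType.

Record simplicial_complex := SimplicialComplex {
  faces :> {set {set V}};
  complex_closed : forall F G : {set V}, G \in faces -> F \subset G -> F \in faces
}.

Variable K : simplicial_complex.

Record face (n : nat) := Face {
  fset_of_face :> {set V};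
  faceP : (fset_of_face \in faces K) && (#|fset_of_face| == n.+1)
}.
HB.instance Definition _ n := [isSub for @fset_of_face n].
HB.instance Definition _ n := [Finite of face n by <:].

Definition complex_dim : nat := \max_(F in faces K) #|F|.-1.

Definition facet (F : {set V}) : bool :=
  maxset (fun A : {set V} => A \in faces K) F.

(* F \in d G; only used with F a face of K *)
Definition bdry (F G : {set V}) : bool :=
  [&& G \in faces K, F \subset G & #|G| == #|F|.+1].

Definition adj n (F F' : face n) : bool :=
  (F != F') && [exists G : face n.+1, bdry F G && bdry F' G].

Definition walk n (l : nat) (F F' : face n) : bool :=
  [exists p : l.-tuple (face n), path (@adj n) F p && (last F p == F')].

(* any two n-faces are joined: the (n+1)-path connectedness of K *)
Definition path_connected n : Prop :=
  forall F F' : face n, exists l, walk l F F'.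

(* The value 0 for faces that no walk connects is a dummy. *)
Definition dist n (F F' : face n) : nat :=
  if pselect (exists l, walk l F F') is left w then ex_minn w else 0.

Definition ordering (n : nat) := {ffun 'I_n.+1 -> V}.

Definition reorder n (t : ordering n) (s : 'S_n.+1) : ordering n :=
  [ffun j => t (s j)].

(* [v_0, ..., v_(n+1)] without v_j *)
Definition omit n (t : ordering n.+1) (j : 'I_n.+2) : ordering n :=
  [ffun k => t (lift j k)].

Definition orders n (t : ordering n) (F : {set V}) : bool :=
  injectiveb t && ([set t j | j : 'I_n.+1] == F).

Definition ordered_face n (t : ordering n) : bool :=
  injectiveb t && ([set t j | j : 'I_n.+1] \in faces K).

(* For injective orderings t and u, [u] = (rel_sign t u) [t] when u reorders t;
   otherwise the sum is empty. *)
Definition rel_sign (A : pzRingType) n (t u : ordering n) : A :=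
  \sum_(s : 'S_n.+1 | u == reorder t s) (-1) ^+ s.

(* An oriented face (b, t) stands for (-1)^b [t].  In dimension n > 0 the sign
   adds nothing, since an odd reordering reverses the orientation; a 0-face has
   only one ordering, and b provides its two orientations. *)
Definition oriented n := (bool * ordering n)%type.

(* sgn([E], d[G]) *)
Definition incidence n (E : oriented n) (G : oriented n.+1) : int :=
  (-1) ^+ E.1 * (-1) ^+ G.1 *
  \sum_(j < n.+2) (-1) ^+ j * rel_sign int E.2 (omit G.2 j).

Definition orientable n : Prop :=
  exists (o : face n -> oriented n) (o' : face n.+1 -> oriented n.+1),
    [/\ forall F, orders (o F).2 F,
        forall G, orders (o' G).2 G &
        forall (G : face n.+1) (E E' : face n), bdry E G -> bdry E' G ->
          incidence (o E) (o' G) * incidence (o E') (o' G) = 1].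

Lemma card_face n (F : face n) : #|F| = n.+1.
Proof. by case: F => F /= /andP[_ /eqP]. Qed.

Lemma face_in n (F : face n) : (F : {set V}) \in faces K.
Proof. by case: F => F /= /andP[]. Qed.

Definition std_order n (F : face n) : ordering n :=
  [ffun j => enum_val (cast_ord (esym (card_face F)) j)].

Lemma std_orderP n (F : face n) : orders (std_order F) F.
Proof.
have inj : injective (std_order F).
  by move=> j k; rewrite !ffunE => /enum_val_inj /cast_ord_inj.
apply/andP; split; first exact/injectiveP.
rewrite eqEcard card_imset // card_ord card_face leqnn andbT.
by apply/subsetP => v /imsetP[j _ ->]; rewrite ffunE enum_valP.
Qed.

Lemma reorderM n (t : ordering n) (s s' : 'S_n.+1) :
  reorder (reorder t s) s' = reorder t (s' * s)%g.
Proof. by apply/ffunP => j; rewrite !ffunE permM. Qed.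

Lemma reorder1 n (t : ordering n) : reorder t 1%g = t.
Proof. by apply/ffunP => j; rewrite !ffunE perm1. Qed.

Lemma reorder_inj n (t : ordering n) :
  injective t -> injective (reorder t).
Proof.
move=> inj s s' /ffunP e; apply/permP => j.
by apply: inj; have := e j; rewrite !ffunE.
Qed.

Lemma reorder_im n (t : ordering n) (s : 'S_n.+1) :
  [set reorder t s j | j : 'I_n.+1] = [set t j | j : 'I_n.+1].
Proof.
apply/setP => v; apply/imsetP/imsetP => -[j _ ->].
  by exists (s j); rewrite ?ffunE.
by exists ((s^-1)%g j); rewrite ?ffunE ?permKV.
Qed.

Lemma reorder_injb n (t : ordering n) (s : 'S_n.+1) :
  injectiveb (reorder t s) = injectiveb t.
Proof.
apply/injectiveP/injectiveP => inj j k.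
  move=> e; apply: (@perm_inj _ (s^-1)%g); apply: inj.
  by rewrite !ffunE !permKV.
by rewrite !ffunE => /inj /perm_inj.
Qed.

Lemma reorder_face n (t : ordering n) (s : 'S_n.+1) :
  ordered_face (reorder t s) = ordered_face t.
Proof. by rewrite /ordered_face reorder_im reorder_injb. Qed.

Lemma same_orders n (t u : ordering n) (F : {set V}) :
  orders t F -> orders u F -> exists s, u = reorder t s.
Proof.
move=> /andP[/injectiveP ti /eqP tF] /andP[/injectiveP ui /eqP uF].
have ex j : exists k, t k == u j.
  have : u j \in F by rewrite -uF imset_f.
  by rewrite -tF => /imsetP[k _ ->]; exists k.
have e j : t (xchoose (ex j)) = u j by apply/eqP/(xchooseP (ex j)).
have inj : injective (fun j => xchoose (ex j)).
  by move=> j k /(congr1 t); rewrite !e => /ui.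
by exists (perm inj); apply/ffunP => j; rewrite ffunE permE e.
Qed.

Lemma rel_sign_reorder (A : pzRingType) n (t : ordering n) (s : 'S_n.+1) :
  injective t -> rel_sign A t (reorder t s) = (-1) ^+ s.
Proof.
move=> ti; rewrite /rel_sign (big_pred1 s) // => s' /=.
by rewrite (inj_eq (reorder_inj ti)) eq_sym.
Qed.

Lemma rel_sign_alt (A : pzRingType) n (t u : ordering n) (s : 'S_n.+1) :
  rel_sign A t (reorder u s) = (-1) ^+ s * rel_sign A t u.
Proof.
rewrite /rel_sign mulr_sumr (reindex_inj (mulgI s)) /=.
apply: eq_big => [s'|s' _]; last by rewrite odd_permM signr_addb.
rewrite -reorderM; apply/eqP/eqP => [/ffunP e|-> //].
apply/ffunP => j; have := e ((s^-1)%g j).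
by rewrite !ffunE permKV.
Qed.

Lemma lift_perm_dec n (s : 'S_n.+2) (j : 'I_n.+2) :
  exists s' : 'S_n.+1, s = lift_perm j (s j) s'.
Proof.
have ex k : exists l, s (lift j k) == lift (s j) l.
  case: (unliftP (s j) (s (lift j k))) => [l ->|]; first by exists l.
  by move/perm_inj/eqP; rewrite eq_sym (negbTE (neq_lift _ _)).
have e k : lift (s j) (xchoose (ex k)) = s (lift j k).
  by apply/esym/eqP/(xchooseP (ex k)).
have inj : injective (fun k => xchoose (ex k)).
  by move=> k l /(congr1 (lift (s j))); rewrite !e => /perm_inj /lift_inj.
exists (perm inj); apply/permP => k.
case: (unliftP j k) => [l ->|->]; last by rewrite lift_perm_id.
by rewrite lift_perm_lift permE e.
Qed.

End Faces.

Section Weights.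
Variables (R : realType) (V : finType) (K : simplicial_complex V).

Definition deg (w : {set V} -> R) (F : {set V}) : R :=
  \sum_(G : {set V} | bdry K F G) w G.

(* Recursion on codimension; the fuel #|V| suffices, by [weightE]. *)
Fixpoint weight_rec (n : nat) (F : {set V}) : R :=
  if facet K F then 1 else
  if n is n'.+1 then deg (weight_rec n') F else 0.

Definition weight : {set V} -> R := weight_rec #|V|.

Lemma bdry_ex (F : {set V}) :
  F \in faces K -> ~~ facet K F -> exists G, bdry K F G.
Proof.
move=> FK nF.
have [G maxG FG] := maxset_exists (P := fun A => A \in faces K) FK.
have pFG : F \proper G.
  rewrite properEneq FG andbT; apply: contra nF => /eqP ->; exact: maxG.
have [_ [v vG vF]] := properP pFG.
exists (v |: F); apply/and3P; split.
- apply: (@complex_closed _ K _ G); first by case/maxsetP: maxG.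
  by rewrite subUset sub1set vG.
- exact: subsetUr.
- by rewrite cardsU1 vF.
Qed.

Lemma codim0_facet (F : {set V}) :
  F \in faces K -> (#|V| - #|F| = 0)%N -> facet K F.
Proof.
move=> FK /eqP; rewrite subn_eq0 => le.
have -> : F = setT by apply/eqP; rewrite eqEcard subsetT cardsT.
apply/maxsetP; split=> [|B _]; last by rewrite subTset => /eqP.
suff <- : F = setT by [].
by apply/eqP; rewrite eqEcard subsetT cardsT.
Qed.

Lemma bdry_codim n (F G : {set V}) :
  bdry K F G -> (#|V| - #|F| <= n.+1)%N -> (#|V| - #|G| <= n)%N.
Proof.
by case/and3P => _ _ /eqP ->; rewrite subnS; case: (#|V| - #|F|)%N.
Qed.

Lemma weight_rec_stable n m (F : {set V}) : F \in faces K ->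
  (#|V| - #|F| <= n)%N -> (#|V| - #|F| <= m)%N ->
  weight_rec n F = weight_rec m F.
Proof.
elim: n m F => [|n IH] [|m] F FK //=; case: ifP => // /negbT nF.
- by rewrite leqn0 => /eqP /(codim0_facet FK); rewrite (negbTE nF).
- by move=> _; rewrite leqn0 => /eqP /(codim0_facet FK); rewrite (negbTE nF).
- move=> ln lm; apply: eq_bigr => G FG; apply: IH; first by case/and3P: FG.
    exact: bdry_codim FG ln.
  exact: bdry_codim FG lm.
Qed.

Lemma weightE (F : {set V}) : F \in faces K ->
  weight F = if facet K F then 1 else deg weight F.
Proof.
move=> FK; rewrite {1}/weight (@weight_rec_stable _ #|V|.+1) ?leq_subr //.
by apply: leqW; rewrite leq_subr.
Qed.

Lemma weight_gt0 (F : {set V}) : F \in faces K -> 0 < weight F.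
Proof.
have [n] := ubnP (#|V| - #|F|); elim: n F => // n IH F; rewrite ltnS => le FK.
rewrite weightE //; case: ifP => // /negbT nF.
have [G FG] := bdry_ex FK nF.
have pos H : bdry K F H -> 0 < weight H.
  move=> FH; have HK : H \in faces K by case/and3P: FH.
  have /and3P[_ _ /eqP cH] := FH.
  apply: IH => //; apply: leq_trans le; rewrite cH subnS.
  case E: (#|V| - #|F|)%N => [|//].
  by rewrite (codim0_facet FK E) in nF.
rewrite /deg (bigD1 G) //= ltr_pwDl ?pos // sumr_ge0 // => H /andP[FH _].
exact/ltW/pos.
Qed.

End Weights.

Section Cochains.
Variables (R : realType) (V : finType) (K : simplicial_complex V).

(* C^n(K, R): a linear form on C_n(K, R), given by its values on the ordered
   n-faces, extended by 0 to the other (n+1)-tuples of vertices. *)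
Definition is_cochain n : {pred {ffun ordering V n -> R^o}} := fun f =>
  [forall t : ordering V n, (ordered_face K t || (f t == 0)) &&
     [forall s : 'S_n.+1, f (reorder t s) == (-1) ^+ s * f t]].

Record cochain n := Cochain {
  cochain_fun :> {ffun ordering V n -> R^o};
  cochainP : cochain_fun \in @is_cochain n
}.

HB.instance Definition _ n := [isSub for @cochain_fun n].
HB.instance Definition _ n := [Choice of cochain n by <:].

Lemma cochain_inP n (f : {ffun ordering V n -> R^o}) :
  reflect ((forall t, ~~ ordered_face K t -> f t = 0) /\
           (forall t s, f (reorder t s) = (-1) ^+ s * f t))
          (f \in @is_cochain n).
Proof.
apply: (iffP forallP) => [h|[h0 h1] t]; first split.
- by move=> t /negbTE nt; have /andP[] := h t; rewrite nt => /eqP.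
- by move=> t s; have /andP[_ /forallP /(_ s) /eqP] := h t.
- apply/andP; split; last by apply/forallP => s; rewrite h1.
  by case: (boolP (ordered_face K t)) => //= /h0 ->.
Qed.

Lemma is_cochain_submod n : submod_closed (@is_cochain n).
Proof.
split=> [|a f g /cochain_inP[f0 f1] /cochain_inP[g0 g1]].
  by apply/cochain_inP; split=> [t _|t s]; rewrite !ffunE ?mulr0.
apply/cochain_inP; split=> [t nt|t s]; rewrite !ffunE.
  by rewrite f0 // g0 // scaler0 addr0.
by rewrite f1 g1 mulrDr scalerAr.
Qed.

HB.instance Definition _ n :=
  GRing.isSubmodClosed.Build R {ffun ordering V n -> R^o} (@is_cochain n)
    (is_cochain_submod n).
HB.instance Definition _ n :=
  [SubChoice_isSubLmodule of cochain n by <:].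

Lemma coboundary_subproof n (f : cochain n) :
  [ffun t : ordering V n.+1 => if ordered_face K t
     then \sum_(j < n.+2) (-1) ^+ j * f (omit t j) else 0]
    \in @is_cochain n.+1.
Proof.
have /cochain_inP[_ falt] := cochainP f.
apply/cochain_inP; split=> [t /negbTE nt|t s]; rewrite !ffunE ?nt //.
rewrite reorder_face; case: ifP => _; last by rewrite mulr0.
rewrite mulr_sumr [RHS](reindex_inj (@perm_inj _ s)) /=.
apply: eq_bigr => j _.
have [s' es] := lift_perm_dec s j.
have -> : omit (reorder t s) j = reorder (omit t (s j)) s'.
  by apply/ffunP => k; rewrite !ffunE {1}es lift_perm_lift.
rewrite falt !mulrA; congr (_ * _).
have -> : (-1) ^+ s = (-1) ^+ j * (-1) ^+ s j * (-1) ^+ s' :> R^o.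
  by rewrite {1}es odd_lift_perm !signr_addb !signr_odd.
rewrite [_ * (-1) ^+ s' * _]mulrAC; congr (_ * _).
by rewrite -mulrA -expr2 sqrr_sign mulr1.
Qed.

Definition coboundary n (f : cochain n) : cochain n.+1 :=
  Cochain (coboundary_subproof f).

Definition inner n (f g : cochain n) : R :=
  \sum_(F : face K n) weight R K F * f (std_order F) * g (std_order F).

Lemma orders_ordered_face n (t : ordering V n) (F : face K n) :
  orders t F -> ordered_face K t.
Proof. by case/andP=> ti /eqP tF; rewrite /ordered_face ti tF face_in. Qed.

(* [inner] does not depend on the choice of [std_order] *)
Lemma inner_orders n (o : face K n -> ordering V n) (f g : cochain n) :
  (forall F, orders (o F) F) ->
  inner f g = \sum_(F : face K n) weight R K F * f (o F) * g (o F).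
Proof.
move=> oP; apply: eq_bigr => F _.
have [s ->] := same_orders (std_orderP F) (oP F).
have /cochain_inP[_ fa] := cochainP f; have /cochain_inP[_ ga] := cochainP g.
by rewrite fa ga -!mulrA; congr (_ * _); rewrite [_ * (_ * g _)]mulrCA signrMK.
Qed.

Lemma dual_subproof n (F : face K n) :
  [ffun t : ordering V n => rel_sign R (std_order F) t] \in @is_cochain n.
Proof.
apply/cochain_inP; split=> [t nt|t s]; rewrite !ffunE ?rel_sign_alt //.
rewrite /rel_sign big1 // => s /eqP et; case/negP: nt.
by rewrite et reorder_face (orders_ordered_face (std_orderP F)).
Qed.

Definition dual n (F : face K n) : cochain n := Cochain (dual_subproof F).

Lemma dualE n (E F : face K n) : dual E (std_order F) = (E == F)%:R.
Proof.
have /andP[/injectiveP Ei /eqP EE] := std_orderP E.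
have /andP[_ /eqP FF] := std_orderP F.
rewrite ffunE; case: eqP => [<-|neq].
  by rewrite -[X in rel_sign _ _ X]reorder1 rel_sign_reorder // odd_perm1.
rewrite /rel_sign big1 // => s /eqP es; case: neq.
by apply: val_inj; rewrite /= -EE -FF es reorder_im.
Qed.

Lemma cochain_eq n (f g : cochain n) :
  (forall F : face K n, f (std_order F) = g (std_order F)) -> f = g.
Proof.
move=> e; apply: val_inj; apply/ffunP => t /=.
have /cochain_inP[f0 fa] := cochainP f; have /cochain_inP[g0 ga] := cochainP g.
case: (boolP (ordered_face K t)) => [/andP[ti tK]|nt]; last by rewrite f0 ?g0.
have cF : ([set t j | j : 'I_n.+1] \in faces K) &&
          (#|[set t j | j : 'I_n.+1]| == n.+1).
  by rewrite tK card_imset ?card_ord /=; last exact/injectiveP.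
have tF : orders t (Face cF) by rewrite /orders ti /=.
have [s ->] := same_orders (std_orderP (Face cF)) tF.
by rewrite fa ga e.
Qed.

Lemma cochain_sum n I (r : seq I) (f : I -> cochain n) t :
  (\sum_(i <- r) f i : cochain n) t = \sum_(i <- r) f i t.
Proof.
by elim/big_rec2: _ => [|i x y _ <-]; rewrite /= ?ffunE.
Qed.

Lemma coboundary_linear n : linear (@coboundary n).
Proof.
move=> a f g; apply: val_inj; apply/ffunP => t; rewrite /= !ffunE.
case: ifP => _; last by rewrite scaler0 addr0.
rewrite scaler_sumr -big_split /=; apply: eq_bigr => j _.
by rewrite !ffunE mulrDr /GRing.scale /= mulrCA.
Qed.
HB.instance Definition _ n :=
  GRing.isLinear.Build R (cochain n) (cochain n.+1) *:%R (@coboundary n)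
    (@coboundary_linear n).

Definition is_adjoint n m (T : cochain n -> cochain m)
    (S : cochain m -> cochain n) : Prop :=
  forall f g, inner (T f) g = inner f (S g).

Lemma inner_suml n I (r : seq I) (c : I -> R) (f : I -> cochain n) g :
  inner (\sum_(i <- r) c i *: f i) g = \sum_(i <- r) c i * inner (f i) g.
Proof.
rewrite /inner; under [RHS]eq_bigr do rewrite mulr_sumr.
rewrite exchange_big /=; apply: eq_bigr => F _.
rewrite cochain_sum mulr_sumr mulr_suml; apply: eq_bigr => i _.
by rewrite /= ffunE /GRing.scale /= !mulrA; congr (_ * _ * _); rewrite mulrC.
Qed.

Lemma coboundary_adjoint_ex n : exists S, is_adjoint (@coboundary n) S.
Proof.
exists (fun g => \sum_(F : face K n)
  ((weight R K F)^-1 * inner (coboundary (dual F)) g) *: dual F) => f g.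
have fE : f = \sum_(F : face K n) f (std_order F) *: dual F.
  apply: cochain_eq => F; rewrite cochain_sum (bigD1 F) //= big1.
    by rewrite addr0 ffunE dualE eqxx /GRing.scale /= mulr1.
  by move=> E /negbTE EF; rewrite ffunE dualE EF /GRing.scale /= mulr0.
rewrite [in LHS]fE linear_sum /=; under eq_bigr do rewrite linearZ /=.
rewrite inner_suml [RHS]/inner; apply: eq_bigr => F _.
rewrite cochain_sum (bigD1 F) //= big1; last first.
  by move=> E /negbTE EF; rewrite ffunE dualE EF /GRing.scale /= mulr0.
rewrite addr0 ffunE dualE eqxx /GRing.scale /= mulr1.
rewrite [weight _ _ _ * _]mulrC -mulrA mulVKf // gt_eqF //.
exact/weight_gt0/face_in.
Qed.

Definition coboundary_adj n : cochain n.+1 -> cochain n :=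
  sval (cid (@coboundary_adjoint_ex n)).

Lemma coboundary_adjP n : is_adjoint (@coboundary n) (@coboundary_adj n).
Proof. exact: svalP. Qed.

Definition up_laplacian n (f : cochain n) : cochain n :=
  coboundary_adj (coboundary f).

End Cochains.

Definition is_eigenvalue (R : realType) (U : lmodType R) (T : U -> U) (a : R) :=
  exists2 f : U, f != 0 & T f = a *: f.

Section Curvature.
Variables (R : realType) (V : finType) (K : simplicial_complex V) (n : nat).

(* The [G] picked is unique, being the union of F and F'. *)
Definition ricci_measure (F F' : face K n) : R :=
  if F' == F then 0 else
  if [pick G : face K n.+1 | bdry K F G && bdry K F' G] is Some G
  then weight R K G / (n.+1%:R * deg K (weight R K) F) else 0.

Definition coupling (mu nu : face K n -> R) (A : face K n -> face K n -> R) :=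
  [/\ forall u v, 0 <= A u v <= 1,
      forall u, \sum_v A u v = mu u &
      forall v, \sum_u A u v = nu v].

Definition wasserstein (mu nu : face K n -> R) : R :=
  inf [set c : R | exists2 A, coupling mu nu A &
         c = \sum_u \sum_v A u v * (dist u v)%:R]%classic.

Definition ricci (F F' : face K n) : R :=
  1 - wasserstein (ricci_measure F) (ricci_measure F') / (dist F F')%:R.

End Curvature.

(* Main.v *)
Require Import Defs.
From mathcomp Require Import boolp classical_sets reals.
From mathcomp Require Import all_boot all_order all_algebra all_fingroup.
From mathcomp Require Import ring lra.
Import Order.TTheory GRing.Theory Num.Theory.
Local Open Scope ring_scope.

Set Implicit Arguments.
Unset Strict Implicit.
Unset Printing Implicit Defensive.

(** Write phi(F) for the value of a cochain f on the oriented face o(F), where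
    o and o' are orientations of the n- and (n+1)-faces as provided by
    orientability.  All the n-faces in the boundary of a given G then have the
    same incidence number with G, so up to a sign depending only on G
    (delta f)(G) is the sum of phi over the boundary of G
    ([coherent_coboundary]).  Testing the equation Delta f = lambda f against
    the dual basis therefore makes every sign disappear
    ([eigenfunction_eq]):
      lambda w(F) phi(F) = sum_(G > F) w(G) sum_(E < G) phi(E).
    No n-face is a facet ([exists_bdry]), hence w(F) = deg F; isolating the terms E = F turns
    this into an eigenvalue equation for a random walk
    ([walk_eigenfunction]):
      (lambda - 1) phi(F) = (n+1) sum_E m_F(E) phi(E).

    Curvature now bounds the spectrum as for graphs.  Let L be the
    largest variation of phi across an edge of the adjacency relation.  Since
    the constants belong to the eigenvalue n+2, phi is not constant, so L > 0
    by path connectedness ([exists_max_variation]), and phi is L-Lipschitz for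
    the path distance ([lipschitz_dist]).  The easy half of Kantorovich duality
    ([wasserstein_lipschitz]) gives, on an edge (F, E) attaining L,
      |lambda - 1| L = (n+1) |sum m_F phi - sum m_E phi|
                    <= (n+1) L W(m_F, m_E) <= (n+1) L (1 - k),
    that is |lambda - 1| <= (n+1) (1 - k), which is the pair of bounds. *)

(** * Orderings, incidence and boundaries of faces *)

Section Orders.
Variables (V : finType) (K : simplicial_complex V).

Lemma rel_sign_eq0 (A : pzRingType) n (t u : ordering V n) (F : {set V}) :
  orders t F -> ~~ orders u F -> rel_sign A t u = 0.
Proof.
move=> /andP[ti tF]; apply: contraNeq => nz.
have [s /eqP ->|none] := pickP [pred s | u == reorder t s].
  by rewrite /orders reorder_injb reorder_im ti.
by case/eqP: nz; rewrite /rel_sign big_pred0.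
Qed.

Lemma rmorph_rel_sign (R : pzRingType) n (t u : ordering V n) :
  (rel_sign int t u)%:~R = rel_sign R t u.
Proof.
by rewrite /rel_sign rmorph_sum; apply: eq_bigr => s _; rewrite rmorph_sign.
Qed.

Lemma orders_face_inj n (t : ordering V n) (E E' : face K n) :
  orders t E -> orders t E' -> E = E'.
Proof.
by move=> /andP[_ /eqP e] /andP[_ /eqP e']; apply: val_inj; rewrite /= -e -e'.
Qed.

Lemma ordered_faceP n (t : ordering V n) :
  ordered_face K t -> exists E : face K n, orders t E.
Proof.
move=> /andP[ti tK].
have cE : ([set t j | j : 'I_n.+1] \in faces K) &&
          (#|[set t j | j : 'I_n.+1]| == n.+1).
  by rewrite tK card_imset ?card_ord /=; last exact/injectiveP.
by exists (Face cE); rewrite /orders ti /=.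
Qed.

Lemma bdry_faceE n (F : face K n) (G : face K n.+1) :
  bdry K F G = ((F : {set V}) \subset G).
Proof. by rewrite /bdry face_in !card_face eqxx andbT. Qed.

Lemma omit_bdry n (t : ordering V n.+1) j (E : face K n) (G : face K n.+1) :
  orders t G -> orders (omit t j) E -> bdry K E G.
Proof.
move=> /andP[_ /eqP tG] /andP[_ /eqP tE]; rewrite bdry_faceE -tG -tE.
by apply/subsetP => v /imsetP[l _ ->]; rewrite ffunE imset_f.
Qed.

(** Lets sums weighted by incidence numbers run over all the n-faces instead of
    over the boundary of G. *)
Lemma incidence_eq0 n (E : face K n) (G : face K n.+1)
    (a : oriented V n) (b : oriented V n.+1) :
  orders a.2 E -> orders b.2 G -> ~~ bdry K E G -> incidence a b = 0.
Proof.
move=> aE bG nEG; rewrite /incidence big1 ?mulr0 // => j _.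
by rewrite (rel_sign_eq0 _ aE) ?mulr0 //; apply: contra nEG; apply: omit_bdry.
Qed.

(** Two distinct n-faces have a union of at least n+2 vertices, so a common
    (n+1)-face leaves no room for anything else.  This is why the Ricci measure
    involves a single G for each pair of neighbours. *)
Lemma bdry_eq_setU n (F F' : face K n) (G : {set V}) :
  F != F' -> bdry K F G -> bdry K F' G -> G = (F :|: F')%SET.
Proof.
move=> neq /and3P[_ FG /eqP cG] /and3P[_ F'G _].
apply/esym/eqP; rewrite eqEcard subUset FG F'G cG.
rewrite ltnNge; apply: contra neq => le.
have FU : F = (F :|: F')%SET :> {set V}.
  by apply/eqP; rewrite eqEcard finset.subsetUl.
have F'F : (F' : {set V}) \subset F by rewrite FU finset.subsetUr.
apply/eqP/val_inj/esym/eqP.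
by rewrite eqEcard F'F !card_face leqnn.
Qed.

Lemma sum_bdry_face (A : nmodType) n (F : face K n) (f : {set V} -> A) :
  \sum_(G : {set V} | bdry K F G) f G = \sum_(G : face K n.+1 | bdry K F G) f G.
Proof.
pose S := [set val G | G in [set G : face K n.+1 | bdry K F G]]%SET.
have -> : \sum_(G : {set V} | bdry K F G) f G = \sum_(G in S) f G.
  apply: eq_bigl => G; apply/idP/imsetP => [FG|[G' + ->]]; last by rewrite inE.
  have [GK _ /eqP cG] := and3P FG.
  have cF : (G \in faces K) && (#|G| == n.+2) by rewrite GK cG card_face /=.
  by exists (Face cF); rewrite ?inE.
rewrite big_imset /=; last by move=> ? ? _ _; apply: val_inj.
by apply: eq_bigl => G; rewrite inE.
Qed.

Lemma card_bdry n (G : face K n.+1) :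
  #|[pred E : face K n | bdry K E G]| = n.+2.
Proof.
rewrite -(card_imset _ val_inj).
(* n+2 = C(n+2, n+1) counts the subsets of G with n+1 vertices. *)
rewrite -[RHS]bin1 -[RHS]bin_sub ?subn1 //= -[in RHS](card_face G) -cards_draws.
apply: eq_card => A; rewrite !inE; apply/imsetP/andP => [[E + ->]|[AG cA]].
  by rewrite inE bdry_faceE /= card_face eqxx.
have cE : (A \in faces K) && (#|A| == n.+1).
  by rewrite cA andbT; apply: complex_closed AG; apply: face_in.
by exists (Face cE); rewrite ?inE ?bdry_faceE.
Qed.

Lemma adj_bdry n (F F' : face K n) : adj F F' -> exists G, bdry K F G.
Proof. by case/andP => _ /existsP[G /andP[FG _]]; exists G. Qed.

(** An (n+1)-face exists by the dimension hypothesis, and its boundary has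
    n+2 > 1 faces.  So each n-face F has another n-face to be joined to, and
    the first step of a path from F goes through an (n+1)-face above F.
    Consequently F is not a facet and deg F > 0. *)
Lemma exists_bdry n : complex_dim K = n.+1 -> path_connected K n ->
  forall F : face K n, exists G, bdry K F G.
Proof.
move=> dimK conn F.
have [G0 GK eG0] : {G0 | G0 \in faces K & complex_dim K = #|G0|.-1}.
  apply: eq_bigmax_cond; rewrite card_gt0; apply/set0Pn.
  by exists (F : {set V}); apply: face_in.
have cG : #|G0| = n.+2 by move: eG0; rewrite dimK; case: #|G0| => //= m ->.
have cG0 : (G0 \in faces K) && (#|G0| == n.+2) by rewrite GK cG /=.
have [E nEF] : exists E : face K n, E != F.
  have : (1 < #|{: face K n}|)%N.
    apply: leq_trans (max_card [pred E : face K n | bdry K E (Face cG0)]).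
    by rewrite card_bdry.
  rewrite (cardD1 F) ltnS => /card_gt0P[E]; rewrite inE => /andP[nE _].
  by exists E.
have [l /existsP[p /andP[]]] := conn F E.
case: (tval p) => [_ /eqP FE|F' q /andP[/adj_bdry //]].
by rewrite -FE eqxx in nEF.
Qed.

End Orders.

(** * The up Laplacian in coherent orientations *)

Section OrientedValues.
Variables (R : realType) (V : finType) (K : simplicial_complex V) (n : nat).

Definition oriented_value m (f : cochain R K m) (a : oriented V m) : R :=
  (-1) ^+ a.1 * f a.2.

(** The expansion of a cochain in the basis dual to a choice of orderings.  It
    turns the sum over the deleted vertices in the coboundary into a sum over
    n-faces without matching the vertices of G with its boundary. *)
Lemma cochain_expand (o : face K n -> ordering V n) (f : cochain R K n) t :
  (forall E, orders (o E) E) ->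
  f t = \sum_(E : face K n) rel_sign R (o E) t * f (o E).
Proof.
move=> oP; have /cochain_inP[f0 fa] := cochainP f.
have [/ordered_faceP[E tE]|nt] := boolP (ordered_face K t); last first.
  rewrite f0 // big1 // => E _; rewrite (rel_sign_eq0 _ (oP E)) ?mul0r //.
  by apply: contra nt; apply: orders_ordered_face.
rewrite (bigD1 E) //= big1 ?addr0 => [|E' nE]; last first.
  rewrite (rel_sign_eq0 _ (oP E')) ?mul0r //.
  by apply: contra nE => tE'; rewrite (orders_face_inj tE tE').
have [s ->] := same_orders (oP E) tE.
by rewrite fa rel_sign_reorder //; have /andP[/injectiveP] := oP E.
Qed.

Lemma coboundary_oriented_value (o : face K n -> oriented V n)
    (f : cochain R K n) (G : face K n.+1) (b : oriented V n.+1) :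
  (forall E, orders (o E).2 E) -> orders b.2 G ->
  oriented_value (coboundary f) b =
    \sum_(E : face K n) (incidence (o E) b)%:~R * oriented_value f (o E).
Proof.
move=> oP bG; rewrite /oriented_value /= ffunE (orders_ordered_face bG).
under eq_bigr do rewrite (cochain_expand f _ oP) mulr_sumr.
rewrite exchange_big mulr_sumr; apply: eq_bigr => E _.
rewrite /incidence !rmorphM !rmorph_sign rmorph_sum /=.
rewrite -[X in _ = X * _]mulrA [RHS]mulrACA -signr_addb addbb mul1r -mulrA.
congr (_ * _); rewrite mulr_suml; apply: eq_bigr => j _.
by rewrite rmorphM /= rmorph_sign rmorph_rel_sign mulrA.
Qed.

Lemma oriented_valueM m (f g : cochain R K m) (a : oriented V m) :
  oriented_value f a * oriented_value g a = f a.2 * g a.2.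
Proof. by rewrite /oriented_value mulrACA -signr_addb addbb mul1r. Qed.

Lemma inner_oriented m (o : face K m -> oriented V m) (f g : cochain R K m) :
  (forall F, orders (o F).2 F) ->
  inner f g = \sum_(F : face K m)
    weight R K F * (oriented_value f (o F) * oriented_value g (o F)).
Proof.
move=> oP; rewrite (inner_orders f g oP).
by apply: eq_bigr => F _; rewrite oriented_valueM mulrA.
Qed.

Lemma oriented_value_eq0 (o : face K n -> oriented V n) (f : cochain R K n) :
  (forall F, orders (o F).2 F) -> (forall F, oriented_value f (o F) = 0) ->
  f = 0.
Proof.
move=> oP f0; apply: val_inj; apply/ffunP => t; rewrite ffunE /=.
rewrite (cochain_expand f t oP) big1 // => E _.
by have /eqP := f0 E; rewrite mulf_eq0 signr_eq0 => /eqP ->; rewrite mulr0.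
Qed.

Lemma dual_oriented_value (o : face K n -> oriented V n) (E F : face K n) :
  (forall F, orders (o F).2 F) ->
  (oriented_value (dual R E) (o F) == 0) = (F != E).
Proof.
move=> oP; rewrite mulf_eq0 signr_eq0 /=.
have [s ->] := same_orders (std_orderP F) (oP F).
have /cochain_inP[_ alt] := cochainP (dual R E).
rewrite alt mulf_eq0 signr_eq0 /= dualE.
by rewrite pnatr_eq0 eqb0 eq_sym.
Qed.

Section Coherent.
Variables (o : face K n -> oriented V n) (o' : face K n.+1 -> oriented V n.+1).
Hypothesis oP : forall F, orders (o F).2 F.
Hypothesis oP' : forall G, orders (o' G).2 G.
Hypothesis coherent : forall (G : face K n.+1) (E E' : face K n),
  bdry K E G -> bdry K E' G ->
  incidence (o E) (o' G) * incidence (o E') (o' G) = 1.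

(** Coherence makes each product of two incidence numbers at G equal to 1, so
    the signs cancel in any quadratic expression in coboundaries, whatever the
    common value of the incidence numbers is. *)
Lemma coherent_coboundary (f g : cochain R K n) (G : face K n.+1) :
  oriented_value (coboundary f) (o' G) * oriented_value (coboundary g) (o' G) =
  (\sum_(E : face K n | bdry K E G) oriented_value f (o E)) *
  (\sum_(E : face K n | bdry K E G) oriented_value g (o E)).
Proof.
have bd h : oriented_value (coboundary h) (o' G) =
    \sum_(E : face K n | bdry K E G)
      (incidence (o E) (o' G))%:~R * oriented_value h (o E).
  rewrite (coboundary_oriented_value _ oP (oP' G)) [RHS]big_mkcond.
  apply: eq_bigr => E _; case: ifPn => // nEG.
  by rewrite (incidence_eq0 (oP E) (oP' G) nEG) mul0r.
rewrite !bd !mulr_suml; apply: eq_bigr => E EG.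
rewrite !mulr_sumr; apply: eq_bigr => E' E'G.
by rewrite mulrACA -intrM coherent // mul1r.
Qed.

(** Pair the eigenvalue equation with the dual cochain of F: by adjointness
    the left side of the pairing is an inner product of coboundaries, where
    [coherent_coboundary] applies, and the cochain dual to F vanishes on all
    other faces. *)
Lemma eigenfunction_eq (lambda : R) (f : cochain R K n) (F : face K n) :
  up_laplacian f = lambda *: f ->
  lambda * weight R K F * oriented_value f (o F) =
  \sum_(G : face K n.+1 | bdry K F G) weight R K G *
    \sum_(E : face K n | bdry K E G) oriented_value f (o E).
Proof.
move=> eigf; pose d E := oriented_value (dual R F) (o E).
have dF : d F != 0 by rewrite /d dual_oriented_value // eqxx.
have d0 E : E != F -> d E = 0.
  by move=> nE; apply/eqP; rewrite /d dual_oriented_value.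
have val_eig : oriented_value (lambda *: f) (o F) =
    lambda * oriented_value f (o F).
  by rewrite /oriented_value /= ffunE /GRing.scale /= mulrCA.
have e : inner (coboundary (dual R F)) (coboundary f) =
    weight R K F * (d F * (lambda * oriented_value f (o F))).
  rewrite coboundary_adjP -/(up_laplacian f) eigf (inner_oriented _ _ oP).
  rewrite (bigD1 F) //= big1 ?addr0 -/(d F) ?val_eig // => E nE.
  by rewrite -/(d E) d0 // mul0r mulr0.
rewrite (inner_oriented _ _ oP') in e.
apply: (mulfI dF).
transitivity (weight R K F * (d F * (lambda * oriented_value f (o F)))).
  by ring.
rewrite -e mulr_sumr [RHS]big_mkcond; apply: eq_bigr => G _.
rewrite coherent_coboundary; case: ifPn => [FG|nFG].
  rewrite (bigD1 F) //= -/(d F) big1 ?addr0; first by rewrite mulrCA.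
  by move=> E /andP[_ nE]; apply: d0.
rewrite big1 ?mul0r ?mulr0 // => E EG; apply: d0.
by apply: contraNneq nFG => <-.
Qed.

End Coherent.
End OrientedValues.

(** * The random walk defined by the Ricci measures *)

Section RandomWalk.
Variables (R : realType) (V : finType) (K : simplicial_complex V) (n : nat).
Implicit Type F E : face K n.

(** At most one G contributes, so the choice in the definition can be replaced
    by a sum, which can then be exchanged with other sums. *)
Lemma ricci_measureE F E :
  ricci_measure R F E =
  \sum_(G : face K n.+1 | [&& bdry K F G, bdry K E G & E != F])
    weight R K G / (n.+1%:R * deg K (weight R K) F).
Proof.
rewrite /ricci_measure; case: eqP => [_|/eqP nEF].
  by rewrite big_pred0 // => G; rewrite !andbF.
case: pickP => [G /andP[FG EG]|none]; last first.
  by rewrite big_pred0 // => G; rewrite andbT none.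
rewrite (big_pred1 G) // => G' /=; rewrite andbT.
apply/idP/eqP => [/andP[FG' EG']|->]; last by rewrite FG.
have nFE : F != E by rewrite eq_sym.
apply: val_inj.
by rewrite /= (bdry_eq_setU nFE FG EG) (bdry_eq_setU nFE FG' EG').
Qed.

Lemma deg_gt0 F : (exists G, bdry K F G) -> 0 < deg K (weight R K) F.
Proof.
move=> [G FG]; rewrite /deg (bigD1 G) //= ltr_pwDl //.
  by apply: weight_gt0; case/and3P: FG.
by apply: sumr_ge0 => H /andP[FH _]; apply/ltW/weight_gt0; case/and3P: FH.
Qed.

Lemma weight_deg F :
  (exists G, bdry K F G) -> weight R K F = deg K (weight R K) F.
Proof.
move=> [G /and3P[GK FG /eqP cG]]; rewrite weightE ?face_in //.
case: ifPn => // /maxsetP[_ /(_ _ GK FG) GF].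
by move: cG; rewrite GF => /eqP; rewrite -[X in X == _]addn0 -addn1 eqn_add2l.
Qed.

(** One step of the walk: choose G above F with probability w(G) / deg F, then
    choose uniformly among the n+1 faces of G other than F. *)
Lemma sum_ricci_measure F (psi : face K n -> R) : (exists G, bdry K F G) ->
  n.+1%:R * deg K (weight R K) F * (\sum_E ricci_measure R F E * psi E) =
  \sum_(G : face K n.+1 | bdry K F G)
    weight R K G * \sum_(E : face K n | bdry K E G && (E != F)) psi E.
Proof.
move=> exG; have dn0 : n.+1%:R * deg K (weight R K) F != 0.
  by rewrite mulf_neq0 ?pnatr_eq0 // gt_eqF // deg_gt0.
under eq_bigr do rewrite ricci_measureE big_mkcond mulr_suml.
rewrite exchange_big [RHS]big_mkcond /=.
move: (_ * deg _ _ _) dn0 => d dn0.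
rewrite mulr_sumr; apply: eq_bigr => G _.
case: ifPn => [FG|nFG]; last by rewrite big1 ?mulr0 // => E _; rewrite mul0r.
rewrite !mulr_sumr [RHS]big_mkcond; apply: eq_bigr => E _ /=.
by case: ifP => _; rewrite ?mul0r ?mulr0 // mulrA [X in X * _]mulrC divfK.
Qed.

Lemma ricci_measure_ge0 F E : 0 <= ricci_measure R F E.
Proof.
rewrite ricci_measureE sumr_ge0 // => G /and3P[FG _ _].
have d0 : 0 < deg K (weight R K) F by apply: deg_gt0; exists G.
by rewrite ltW // divr_gt0 ?mulr_gt0 ?ltr0n ?weight_gt0 ?face_in.
Qed.

Lemma ricci_measure_sum1 F : (exists G, bdry K F G) ->
  \sum_E ricci_measure R F E = 1.
Proof.
move=> exG; have d0 := deg_gt0 exG.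
have dn0 : n.+1%:R * deg K (weight R K) F != 0.
  by rewrite mulf_neq0 ?pnatr_eq0 // gt_eqF.
apply: (mulfI dn0); rewrite mulr1.
have := sum_ricci_measure (fun=> 1) exG.
under [in X in X = _ -> _]eq_bigr do rewrite mulr1.
move->; rewrite /deg sum_bdry_face mulr_sumr; apply: eq_bigr => G FG.
have cG : #|[predD1 [pred E : face K n | bdry K E G] & F]| = n.+1.
  by have := card_bdry G; rewrite (cardD1 F) inE /= FG add1n => -[].
rewrite sumr_const mulrC; congr (_%:R * _); rewrite -[RHS]cG.
by apply: eq_card => E; rewrite !inE andbC.
Qed.

Lemma walk_eigenfunction (lambda : R) (phi : face K n -> R) F :
  (exists G, bdry K F G) ->
  lambda * weight R K F * phi F =
  \sum_(G : face K n.+1 | bdry K F G) weight R K G *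
    \sum_(E : face K n | bdry K E G) phi E ->
  (lambda - 1) * phi F = n.+1%:R * \sum_E ricci_measure R F E * phi E.
Proof.
move=> exG eig; have d0 := deg_gt0 exG.
apply: (mulfI (lt0r_neq0 d0)).
rewrite [RHS]mulrA [_ * n.+1%:R]mulrC sum_ricci_measure //.
rewrite mulrBl mul1r mulrBr.
have -> : deg K (weight R K) F * (lambda * phi F) =
    lambda * weight R K F * phi F.
  by rewrite weight_deg // mulrCA mulrA.
rewrite eig {1}/deg sum_bdry_face mulr_suml -sumrB; apply: eq_bigr => G FG.
by rewrite (bigD1 F) //= mulrDr addrC addKr.
Qed.

End RandomWalk.

(** * Lipschitz functions and optimal transport *)

Section Transport.
Variables (R : realType) (V : finType) (K : simplicial_complex V) (n : nat).
Implicit Types (F E : face K n) (phi mu nu : face K n -> R).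

Lemma lipschitz_dist phi (L : R) :
  path_connected K n -> (forall F E, adj F E -> `|phi F - phi E| <= L) ->
  forall F E, `|phi F - phi E| <= L * (dist F E)%:R.
Proof.
move=> conn lip F E; rewrite /dist; case: pselect => [w|]; last first.
  by move=> nw; case: nw; apply: conn.
case: ex_minnP => l /existsP[p /andP[]] + /eqP <- _.
rewrite -[X in _ * X%:R](size_tuple p).
elim: (tval p) F {w} => [|F' q IH] F /=; first by rewrite subrr normr0 mulr0.
move=> /andP[FF' /IH le]; rewrite -(subrKA (phi F')).
by rewrite (le_trans (ler_normD _ _)) // -natr1 mulrDr mulr1 [leRHS]addrC
  lerD // lip.
Qed.

Lemma dist_adj F E : adj F E -> dist F E = 1.
Proof.
move=> FE; have w1 : walk 1 F E.
  by apply/existsP; exists [tuple E]; rewrite /= FE eqxx.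
rewrite /dist; case: pselect => [w|[]]; last by exists 1%N.
case: ex_minnP => -[|l] /existsP[p /andP[pp /eqP lp]] min.
  by move: FE; rewrite -lp (tuple0 p) /adj eqxx.
by apply/eqP; rewrite eqn_leq min.
Qed.

Lemma coupling_prod mu nu :
  (forall F, 0 <= mu F) -> (forall F, 0 <= nu F) ->
  \sum_F mu F = 1 -> \sum_F nu F = 1 ->
  coupling mu nu (fun F E => mu F * nu E).
Proof.
move=> mu0 nu0 mu1 nu1.
have le1 (rho : face K n -> R) F : (forall F, 0 <= rho F) ->
    \sum_F rho F = 1 -> rho F <= 1.
  by move=> rho0 <-; rewrite (bigD1 F) //= lerDl sumr_ge0.
split=> [F E|F|E].
- by rewrite mulr_ge0 //= mulr_ile1 // le1.
- by rewrite -mulr_sumr nu1 mulr1.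
- by rewrite -mulr_suml mu1 mul1r.
Qed.

Lemma coupling_lipschitz phi (L : R) mu nu A :
  (forall F E, `|phi F - phi E| <= L * (dist F E)%:R) -> coupling mu nu A ->
  `|\sum_F mu F * phi F - \sum_E nu E * phi E| <=
    L * \sum_F \sum_E A F E * (dist F E)%:R.
Proof.
move=> lip [A01 Amu Anu].
have -> : \sum_F mu F * phi F = \sum_F \sum_E A F E * phi F.
  by apply: eq_bigr => F _; rewrite -Amu mulr_suml.
have -> : \sum_E nu E * phi E = \sum_F \sum_E A F E * phi E.
  by rewrite exchange_big; apply: eq_bigr => E _; rewrite -Anu mulr_suml.
rewrite -sumrB mulr_sumr (le_trans (ler_norm_sum _ _ _)) // ler_sum // => F _.
rewrite -sumrB mulr_sumr (le_trans (ler_norm_sum _ _ _)) // ler_sum // => E _.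
have /andP[A0 _] := A01 F E.
by rewrite -mulrBr normrM ger0_norm // mulrCA ler_wpM2l.
Qed.

(** The easy half of Kantorovich duality.  The product coupling is needed
    because the infimum of an empty set of costs would be 0. *)
Lemma wasserstein_lipschitz phi (L : R) mu nu : 0 < L ->
  (forall F, 0 <= mu F) -> (forall F, 0 <= nu F) ->
  \sum_F mu F = 1 -> \sum_F nu F = 1 ->
  (forall F E, `|phi F - phi E| <= L * (dist F E)%:R) ->
  `|\sum_F mu F * phi F - \sum_E nu E * phi E| <= L * wasserstein mu nu.
Proof.
move=> L0 mu0 nu0 mu1 nu1 lip; rewrite mulrC -ler_pdivrMr //.
apply: lb_le_inf.
  by eexists; eexists; [apply: coupling_prod|].
move=> _ [A cA ->]; rewrite ler_pdivrMr // mulrC.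
exact: coupling_lipschitz.
Qed.

Lemma exists_max_variation phi F0 E0 :
  path_connected K n -> phi F0 != phi E0 ->
  exists F E, [/\ adj F E, 0 < `|phi F - phi E| &
    forall F' E', adj F' E' -> `|phi F' - phi E'| <= `|phi F - phi E|].
Proof.
move=> conn nconst.
have [[F1 E1] /= a1 n1] : exists2 p : face K n * face K n,
    adj p.1 p.2 & `|phi p.1 - phi p.2| != 0.
  pose p_ok (p : face K n * face K n) :=
    adj p.1 p.2 && (`|phi p.1 - phi p.2| != 0).
  have [p /andP[]|none] := pickP p_ok; first by exists p.
  (* Otherwise phi is 0-Lipschitz, hence constant. *)
  have lip0 F E : adj F E -> `|phi F - phi E| <= 0.
    by move=> FE; have := none (F, E); rewrite /p_ok /= FE => /negbFE /eqP ->.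
  have := lipschitz_dist conn lip0 F0 E0.
  by rewrite mul0r normr_le0 subr_eq0 (negbTE nconst).
case: (@arg_maxP _ _ _ (F1, E1) (fun p => adj p.1 p.2)
         (fun p => `|phi p.1 - phi p.2|)) => //= -[F E] /= FE max.
exists F, E; split=> // [|F' E' a]; last exact: (max (F', E')).
by apply: lt_le_trans (max (F1, E1) a1); rewrite lt_neqAle eq_sym n1 normr_ge0.
Qed.

End Transport.

(** * The spectral bounds *)

Theorem theorem1p3 (R : realType) (V : finType) (K : simplicial_complex V)
    (i : nat) (lambda k : R) :
  orientable K i -> path_connected K i -> complex_dim K = i.+1 ->
  is_eigenvalue (@up_laplacian R V K i) lambda -> lambda <> i.+2%:R ->
  (forall F F' : face K i, adj F F' -> k <= ricci R F F') ->
  i.+1%:R * k - i%:R <= lambda <= i.+2%:R - i.+1%:R * k.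
Proof.
move=> [o [o' [oP oP' coh]]] conn dimK [f fn0 eigf] lambdaN curv.
pose phi F := oriented_value f (o F).
have exG := exists_bdry dimK conn.
have eig F : (lambda - 1) * phi F =
    i.+1%:R * \sum_E ricci_measure R F E * phi E.
  by apply: walk_eigenfunction => //; apply: eigenfunction_eq.
(* A nonzero constant phi is fixed by averaging, so lambda - 1 = i+1. *)
have [[F0 E0] /= nconst] : exists p : face K i * face K i, phi p.1 != phi p.2.
  have [F phiF|phi0] := pickP [pred F | phi F != 0]; last first.
    case/eqP: fn0; apply: (oriented_value_eq0 oP) => F.
    by have /negbFE/eqP := phi0 F.
  have [E phiE|const] := pickP [pred E | phi F != phi E]; first by exists (F, E).
  case: lambdaN; have := eig F.
  under eq_bigr => E _ do rewrite -(eqP (negbFE (const E))).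
  rewrite -mulr_suml ricci_measure_sum1 // mul1r => /(mulIf phiF) l1.
  by rewrite -[lambda](subrK 1) l1 natr1.
have [F [E [FE L0 lip]]] := exists_max_variation conn nconst.
set L := `|phi F - phi E| in L0 lip.
have W : L * wasserstein (ricci_measure R F) (ricci_measure R E) <= L * (1 - k).
  rewrite ler_pM2l // lerBrDl -lerBrDr.
  by have := curv F E FE; rewrite /ricci (dist_adj FE) divr1.
have key : `|lambda - 1| <= i.+1%:R * (1 - k).
  rewrite -(ler_pM2r L0) -normrM mulrBr !eig -mulrBr normrM normr_nat -mulrA.
  rewrite ler_wpM2l ?ler0n // mulrC; apply: le_trans W.
  apply: wasserstein_lipschitz => //; try exact: ricci_measure_ge0.
  - exact: ricci_measure_sum1.
  - exact: ricci_measure_sum1.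
  - exact: lipschitz_dist.
move: key; rewrite ler_norml mulrBr mulr1 => /andP[lo hi].
by apply/andP; split; lra.
Qed.
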